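(* Every connected unit interval graph $G$ has a spanning even tree, unless $G$ is isomorphic to a path of odd length.
   Context: All graphs are finite and simple. A graph $G=(V,E)$ is a unit interval graph if there is a family of closed intervals $\{I_v : v\in V\}$ of the real line, all of the same (unit) length, such that distinct $u,v$ are adjacent in $G$ if and only if $I_u\cap I_v\neq\emptyset$. The length of a path is its number of edges. A leaf of a tree is a vertex of degree $1$. A tree is even if for every pair of distinct leaves, the number of edges of the unique path between them is even. A spanning even tree of $G$ is a spanning tree of $G$ that is even. *)

(* Defs.v *)
From HB Require Import structures.
From mathcomp Require Import all_boot all_order all_algebra.
From mathcomp Require Import boolp classical_sets set_interval reals.
Set Implicit Arguments.
Unset Strict Implicit.
Unset Printing Implicit Defensive.
Import Order.TTheory GRing.Theory Num.Theory.

(* A finite simple graph is a finite vertex type together with a symmetric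
   irreflexive boolean adjacency relation. *)
Definition simple_graph (T : finType) (e : rel T) : Prop :=
  symmetric e /\ irreflexive e.

(* The null graph is not considered connected. *)
Definition connected_graph (T : finType) (e : rel T) : Prop :=
  0 < #|T| /\ forall x y : T, connect e x y.

Definition degree (T : finType) (e : rel T) (x : T) : nat := #|[pred y | e x y]|.

(* [a v] is the left endpoint of the interval of [v]. *)
Definition unit_interval_graph (R : realType) (T : finType) (e : rel T) : Prop :=
  exists a : T -> R, forall u v : T, u != v ->
    (e u v <-> (`[a u, a u + 1] `&` `[a v, a v + 1] !=set0)%R%classic).

(* [ucycle] alone also holds for a single edge traversed back and forth, hence
   the bound on the size. *)
Definition acyclic_graph (T : finType) (e : rel T) : Prop :=
  forall c : seq T, 2 < size c -> ~ ucycle e c.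

Definition tree (T : finType) (e : rel T) : Prop :=
  [/\ simple_graph e, connected_graph e & acyclic_graph e].

Definition leaf (T : finType) (e : rel T) (x : T) : Prop := degree e x = 1.

(* [p] omits the starting vertex [x], so [size p] is the number of edges of the
   path [x :: p]. *)
Definition even_tree (T : finType) (e : rel T) : Prop :=
  tree e /\
  forall x y : T, leaf e x -> leaf e y -> x <> y ->
  forall p : seq T, path e x p -> uniq (x :: p) -> last x p = y ->
    ~~ odd (size p).

Definition spanning_even_tree (T : finType) (e t : rel T) : Prop :=
  subrel t e /\ even_tree t.

Definition graph_iso (T U : finType) (e : rel T) (f : rel U) : Prop :=
  exists2 h : T -> U, bijective h & forall x y : T, f (h x) (h y) = e x y.

(* The path with [k] edges, hence [k.+1] vertices. *)
Definition path_graph (k : nat) : rel 'I_k.+1 :=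
  fun i j => (i.+1 == j) || (j.+1 == i).

(* Main.v *)
Require Import Defs.
From HB Require Import structures.
From mathcomp Require Import all_boot all_order all_algebra.
From mathcomp Require Import boolp classical_sets set_interval reals.
From mathcomp Require Import zify lra.

Set Implicit Arguments.
Unset Strict Implicit.
Unset Printing Implicit Defensive.
Import Order.TTheory GRing.Theory Num.Theory.

(** Sorting the vertices by left endpoint gives a Hamiltonian path
    [v_0, ..., v_(n-1)], which is itself an even tree when [n] is odd.  When [n]
    is even and [G] is not a path, some [v_i] is adjacent to [v_(i+2)].  Bypassing
    [v_(i+1)] leaves a path of even length, to which [v_(i+1)] can be attached as a
    leaf at whichever of [v_i] and [v_(i+2)] has odd position on that path; then
    all leaves lie at even distance from [v_0].  Reversing the order exchanges
    the two cases, so [i] may be assumed odd. *)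

(** * Trees given by a parent map *)

Section ParentTree.

Variables (T : finType) (r : T) (par : T -> T) (m : T -> nat).
Hypothesis par_lt : forall x, x != r -> m (par x) < m x.

(** The guards discard the value of [par] at the root [r], about which nothing is assumed. *)
Definition parent_rel : rel T :=
  fun x y => (x != r) && (par x == y) || (y != r) && (par y == x).

Lemma parent_rel_sym : symmetric parent_rel.
Proof. by move=> x y; rewrite /parent_rel orbC. Qed.

Lemma parent_rel_par x : x != r -> parent_rel x (par x).
Proof. by move=> xr; rewrite /parent_rel xr eqxx. Qed.

(** Were [x] instead the parent of [y], its measure would be strictly smaller. *)
Lemma parent_rel_le x y : parent_rel x y -> m y <= m x -> y = par x.
Proof.
case/orP=> /andP[yr /eqP <-] // le_yx.
by move: (par_lt yr); rewrite ltnNge le_yx.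
Qed.

Lemma parent_rel_irr : irreflexive parent_rel.
Proof.
move=> x; apply/negP; rewrite /parent_rel orbb => /andP[xr /eqP px].
by move: (par_lt xr); rewrite px ltnn.
Qed.

Lemma parent_rel_connect_root x : connect parent_rel x r.
Proof.
move: {2}(m x) (leqnn (m x)) => k.
elim: k x => [|k IHk] x le_xk; have [->|xr] := eqVneq x r; rewrite ?connect0 //.
- by move: (leq_trans (par_lt xr) le_xk).
- apply: connect_trans (connect1 (parent_rel_par xr)) _.
  by apply: IHk; rewrite -ltnS; exact: leq_trans (par_lt xr) le_xk.
Qed.

(* The neighbours on a cycle of a vertex maximizing [m] would both be its
   parent. *)
Lemma parent_rel_acyclic : acyclic_graph parent_rel.
Proof.
move=> c; case: c => [|x0 c0] // sz_c /andP[].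
set c := x0 :: c0 in sz_c * => cyc_c uniq_c.
case: (arg_maxnP (P := [in c]) m (mem_head x0 c0)) => x xc max_x.
case: (rot_to xc) => i [|y c'] rot_c.
  by move: sz_c; rewrite -(size_rot i) rot_c.
have max_c z : z \in rot i c -> m z <= m x by rewrite mem_rot; apply: max_x.
move: cyc_c uniq_c sz_c max_c.
rewrite -(rot_cycle i) -(rot_uniq i) -(size_rot i) {}rot_c.
case/lastP: c' => [//|c' z] /=.
rewrite rcons_path last_rcons => /andP[xy /andP[_ zx]].
move=> /and3P[_ + _] _ max_c.
have -> : y = par x by apply: parent_rel_le xy _; apply: max_c; rewrite !inE eqxx orbT.
have -> : z = par x.
  apply: parent_rel_le; first by rewrite parent_rel_sym.
  by apply: max_c; rewrite !inE mem_rcons mem_head !orbT.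
by rewrite mem_rcons mem_head.
Qed.

Lemma parent_rel_tree : tree parent_rel.
Proof.
split; [by split; [exact: parent_rel_sym | exact: parent_rel_irr] | | ].
- split=> [|x y]; first by apply/card_gt0P; exists r.
  apply: connect_trans (parent_rel_connect_root x) _.
  rewrite (sym_connect_sym parent_rel_sym); exact: parent_rel_connect_root.
- exact: parent_rel_acyclic.
Qed.

End ParentTree.

(** * Even spanning trees from a Hamiltonian path *)

Section SpanningTree.

Variables (T : finType) (e : rel T).
Hypothesis e_sym : symmetric e.

(** The map [col] is a proper 2-colouring of the tree. A vertex coloured [true] has both a parent
    and a child, so every leaf, the root included if it is one, is coloured [false]; a path between
    vertices of the same colour has even length. *)
Lemma spanning_even_tree_of_parents (r : T) (par : T -> T) (m : T -> nat)
    (col : T -> bool) :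
  (forall x, x != r -> m (par x) < m x) ->
  (forall x, x != r -> e x (par x)) ->
  (forall x, x != r -> col (par x) = ~~ col x) ->
  (forall x, col x -> x != r /\ exists2 y, y != r & par y = x) ->
  exists t : rel T, spanning_even_tree e t.
Proof.
move=> par_lt par_e par_col inner.
exists (parent_rel r par); split.
  by move=> x y /orP[]/andP[xr /eqP <-]; [|rewrite e_sym]; exact: par_e.
split; first exact: parent_rel_tree par_lt.
have leaf_col x : leaf (parent_rel r par) x -> ~~ col x.
  move=> leaf_x; apply/negP => /inner[xr [y yr pyx]].
  have := par_lt _ xr; have := par_lt _ yr; rewrite pyx => lt_xy lt_px.
  (* The measure separates the parent of [x] from its child [y], so [x] has degree at least 2. *)
  have neq_y : par x != y by apply/eqP => pxy; move: lt_px; rewrite pxy; lia.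
  have : #|[set par x; y]| <= degree (parent_rel r par) x.
    rewrite /degree; apply: subset_leq_card; apply/fintype.subsetP => z; rewrite !inE => /orP[]/eqP->.
      exact: parent_rel_par.
    by rewrite parent_rel_sym -pyx parent_rel_par.
  by rewrite leaf_x cards2 neq_y.
have path_col x p : path (parent_rel r par) x p ->
    col (last x p) = col x (+) odd (size p).
  elim: p x => [|y p IHp] x /=; first by rewrite addbF.
  case/andP=> xy /IHp ->.
  have -> : col y = ~~ col x.
    by case/orP: xy => /andP[zr /eqP <-]; rewrite par_col ?negbK.
  by rewrite addbN addNb.
move=> x y /leaf_col/negbTE cx /leaf_col/negbTE cy _ p /path_col + _ lastp.
by rewrite lastp cx cy /= => <-.
Qed.

Section Enumeration.

Variables (x0 : T) (s : seq T).
Hypothesis (s_uniq : uniq s) (s_all : forall x, x \in s).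

(** Vertices are replaced by their positions in [s]: position 0 is the root and the position itself
    serves as the measure. *)
Lemma spanning_even_tree_of_indices (p : nat -> nat) (col : nat -> bool) :
  (forall j, 0 < j < size s -> p j < j) ->
  (forall j, 0 < j < size s -> e (nth x0 s j) (nth x0 s (p j))) ->
  (forall j, 0 < j < size s -> col (p j) = ~~ col j) ->
  (forall j, j < size s -> col j ->
     0 < j /\ exists2 k, 0 < k < size s & p k = j) ->
  exists t : rel T, spanning_even_tree e t.
Proof.
move=> p_lt p_e p_col inner.
have idx_lt x : index x s < size s by rewrite index_mem.
have s_gt0 : 0 < size s by exact: leq_ltn_trans (idx_lt x0).
have idx_r x : (x != nth x0 s 0) = (0 < index x s).
  rewrite lt0n; congr negb; apply/eqP/eqP => [->|x_0]; first exact: index_uniq.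
  by rewrite -x_0 nth_index.
have idx_bd x : x != nth x0 s 0 -> 0 < index x s < size s.
  by rewrite idx_r idx_lt andbT.
have pK j : 0 < j < size s -> index (nth x0 s (p j)) s = p j.
  move=> j_bd; rewrite index_uniq //; apply: ltn_trans (p_lt _ j_bd) _.
  by case/andP: j_bd.
apply: (@spanning_even_tree_of_parents (nth x0 s 0)
  (fun x => nth x0 s (p (index x s))) (index^~ s) (fun x => col (index x s))).
- by move=> x /idx_bd x_bd; rewrite pK // p_lt.
- by move=> x /idx_bd x_bd; rewrite -{1}(nth_index x0 (s_all x)) p_e.
- by move=> x /idx_bd x_bd; rewrite pK // p_col.
- move=> x /(inner _ (idx_lt x))[x_gt0 [k k_bd pk]]; split; first by rewrite idx_r.
  case/andP: k_bd => k_gt0 k_lt.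
  have kK : index (nth x0 s k) s = k by rewrite index_uniq.
  by exists (nth x0 s k); rewrite ?idx_r kK ?pk ?nth_index.
Qed.

Hypothesis s_path : forall j, j.+1 < size s -> e (nth x0 s j) (nth x0 s j.+1).

Lemma spanning_even_tree_odd_order :
  odd (size s) -> exists t : rel T, spanning_even_tree e t.
Proof.
move=> odd_s; apply: (@spanning_even_tree_of_indices predn odd).
- by move=> j; lia.
- by case=> [|j] //= j_lt; rewrite e_sym s_path.
- by case=> [|j] //= _; rewrite negbK.
(* The last position is even, so an odd one has a successor. *)
- by move=> j j_lt odd_j; split; [lia | exists j.+1 => //; lia].
Qed.

Lemma spanning_even_tree_odd_triangle k :
  ~~ odd (size s) -> odd k -> k.+2 < size s ->
  e (nth x0 s k) (nth x0 s k.+2) -> exists t : rel T, spanning_even_tree e t.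
Proof.
move=> even_s odd_k k_lt e_k.
(* Position [k.+1] stays below [k] as a leaf, of even depth since [k] is odd. Positions from [k.+2]
   on come one step closer to the root, which flips their parity; the last position is odd, so it
   too gets colour [false]. *)
apply: (@spanning_even_tree_of_indices
  (fun j => if j == k.+2 then k else j.-1)
  (fun j => if j < k.+2 then odd j else ~~ odd j)).
- by move=> j; case: eqP; lia.
- case=> [|j] //= j_lt; case: eqP => [->|_]; first by rewrite e_sym.
  by rewrite e_sym s_path.
- by move=> j j_bd; case: eqP => [->|j_k]; repeat case: ifP; lia.
- move=> j j_lt; case: ifP => j_k col_j; (split; first by lia);
    exists j.+1; try lia; case: eqP; lia.
Qed.

End Enumeration.

Lemma spanning_even_tree_triangle (x0 : T) (s : seq T) (k : nat) :
  uniq s -> (forall x, x \in s) ->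
  (forall j, j.+1 < size s -> e (nth x0 s j) (nth x0 s j.+1)) ->
  ~~ odd (size s) -> k.+2 < size s ->
  e (nth x0 s k) (nth x0 s k.+2) -> exists t : rel T, spanning_even_tree e t.
Proof.
move=> s_uniq s_all s_path even_s k_lt e_k.
have [odd_k|even_k] := boolP (odd k).
  exact: (spanning_even_tree_odd_triangle s_uniq s_all s_path even_s odd_k).
(* Reversal sends position [k.+2] to [size s - k.+3], which is odd because [size s] and [k] are
   even. *)
apply: (@spanning_even_tree_odd_triangle x0 (rev s) _ _ _ (size s - k.+3)).
- by rewrite rev_uniq.
- by move=> x; rewrite mem_rev.
- move=> j; rewrite size_rev => j_lt; rewrite !nth_rev; try lia.
  rewrite e_sym (_ : size s - j.+1 = (size s - j.+2).+1); last by lia.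
  by apply: s_path; lia.
- by rewrite size_rev.
- lia.
- rewrite size_rev; lia.
- rewrite !nth_rev; try lia.
  rewrite e_sym (_ : size s - _ = k); last by lia.
  by rewrite (_ : size s - _ = k.+2) //; lia.
Qed.

End SpanningTree.

(** * Unit interval graphs *)

Lemma unit_interval_adj (R : realType) (T : finType) (e : rel T) :
  unit_interval_graph R e ->
  exists a : T -> R, forall u v : T, u != v ->
    e u v = (a u <= a v + 1)%R && (a v <= a u + 1)%R.
Proof.
case=> a ea; exists a => u v uv; apply/idP/idP.
  case/(ea _ _ uv) => z; rewrite /= !in_itv /= => -[/andP[? ?] /andP[? ?]].
  by apply/andP; split; lra.
case/andP=> ? ?; apply/(ea _ _ uv).
(* Two intervals of equal length that meet share the larger of their left endpoints. *)
by exists (Num.max (a u) (a v)); rewrite /= !in_itv /=; case: (leP (a u) (a v));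
  split; apply/andP; split; lra.
Qed.

Theorem theorem7 (R : realType) (T : finType) (e : rel T) :
  simple_graph e -> connected_graph e -> unit_interval_graph R e ->
  ~ (exists k : nat, odd k /\ graph_iso e (@path_graph k)) ->
  exists t : rel T, spanning_even_tree e t.
Proof.
move=> [e_sym e_irr] [T_gt0 e_conn] /unit_interval_adj[a ea] not_path.
case/card_gt0P: T_gt0 => x0 _.
set s := sort (relpre a <=%R) (enum T).
have s_uniq : uniq s by rewrite sort_uniq enum_uniq.
have s_all x : x \in s by rewrite mem_sort mem_enum.
have idx_lt x : index x s < size s by rewrite index_mem.
have s_sorted i j : i <= j -> j < size s -> (a (nth x0 s i) <= a (nth x0 s j))%R.
  move=> le_ij j_lt.
  apply: (@sorted_leq_nth _ (relpre a <=%R)); rewrite ?inE //=.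
  - by move=> ? ? ?; apply: le_trans.
  - by move=> ?; apply: lexx.
  - by apply: sort_sorted => ? ?; apply: le_total.
  - exact: leq_ltn_trans j_lt.
have s_neq i j : i < j -> j < size s -> nth x0 s i != nth x0 s j.
  move=> lt_ij j_lt; rewrite nth_uniq ?neq_ltn ?lt_ij //.
  exact: ltn_trans j_lt.
(* The sorting makes the other inequality of [ea] automatic. *)
have s_adj i j : i < j -> j < size s ->
    e (nth x0 s i) (nth x0 s j) = (a (nth x0 s j) <= a (nth x0 s i) + 1)%R.
  move=> lt_ij j_lt; rewrite ea ?s_neq //.
  have := s_sorted i j (ltnW lt_ij) j_lt.
  by case: leP => //=; lra.
(* Otherwise the vertices up to [j] would be a union of components. *)
have s_path j : j.+1 < size s -> e (nth x0 s j) (nth x0 s j.+1).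
  move=> j_lt; rewrite s_adj //; rewrite leNgt; apply/negP => gap.
  have : closed e [pred x | a x <= a (nth x0 s j)]%R.
    apply: (intro_closed (sym_connect_sym e_sym)) => x y xy; rewrite !inE => le_xj.
    rewrite leNgt; apply/negP => lt_jy.
    have xNy : x != y by apply/eqP => xy0; move: xy; rewrite xy0 e_irr.
    have le_y : (a (nth x0 s j.+1) <= a y)%R.
      rewrite -(nth_index x0 (s_all y)); apply: (s_sorted) => //.
      rewrite ltnNge; apply/negP => le_yj.
      have := s_sorted _ _ le_yj (ltnW j_lt); rewrite nth_index //; lra.
    by move: xy; rewrite ea // => /andP[_]; lra.
  move/closed_connect/(_ _ _ (e_conn (nth x0 s j) (nth x0 s j.+1))).
  rewrite !inE lexx => /esym; lra.
have [odd_s|even_s] := boolP (odd (size s)).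
  exact: (spanning_even_tree_odd_order e_sym s_uniq s_all s_path odd_s).
have [[k [k_lt e_k]]|no_tri] :=
    pselect (exists k, k.+2 < size s /\ e (nth x0 s k) (nth x0 s k.+2)).
  exact: (spanning_even_tree_triangle e_sym s_uniq s_all s_path even_s k_lt e_k).
(* An edge from [i] to some [j] beyond [i.+2] would force the edge from [i] to [i.+2], whose left
   endpoint lies in between. So the Hamiltonian path is the whole graph. *)
have s_path_only i j : i < j -> j < size s ->
    e (nth x0 s i) (nth x0 s j) = (i.+1 == j).
  move=> lt_ij j_lt; case: eqP => [<-|neq_ij]; first by apply: s_path; lia.
  apply/negP; rewrite s_adj // => le_ji; case: no_tri.
  exists i; split; first by lia.
  rewrite s_adj ?(le_trans _ le_ji) //; try lia.
  by apply: s_sorted; lia.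
case: not_path; exists (size s).-1.
have s_gt0 : 0 < size s by exact: leq_ltn_trans (idx_lt x0).
split; first by lia.
(* Each vertex goes to its position; [inord] avoids a cast between [size s] and [(size s).-1.+1]. *)
exists (fun x => inord (index x s)).
  exists (fun i : 'I__ => nth x0 s i) => [x|i].
    by rewrite inordK ?prednK // nth_index.
  have i_lt : i < size s by rewrite -[ltnRHS](prednK s_gt0).
  by apply: val_inj; rewrite /= index_uniq // inordK.
move=> x y; rewrite /path_graph !inordK ?prednK //.
have := s_path_only (index x s) (index y s); have := s_path_only (index y s) (index x s).
rewrite !nth_index // !idx_lt.
have [->|xy] := eqVneq x y; first by rewrite e_irr; lia.
have : index x s != index y s.
  apply: contra xy => /eqP idx_xy.
  by rewrite -(nth_index x0 (s_all x)) idx_xy nth_index.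
case: ltngtP => // lt_xy _ e_yx e_xy; rewrite (gtn_eqF (leqW lt_xy)).
- by rewrite e_sym e_yx.
- by rewrite orbF e_xy.
Qed.
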